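(* A hypergroupoid $(H,\circ)$ is simple if and only if it is fuzzy simple.
   Context: A hypergroupoid is a nonempty set $H$ with a map $\circ: H\times H\to \mathcal{P}^*(H)$, where $\mathcal{P}^*(H)$ is the set of nonempty subsets of $H$ (no associativity is assumed). For $A,B\in\mathcal{P}^*(H)$ put $A*B=\bigcup_{(a,b)\in A\times B}(a\circ b)$. A nonempty subset $A$ of $H$ is an ideal of $H$ if $H*A\subseteq A$ and $A*H\subseteq A$. $H$ is simple if every ideal $A$ of $H$ satisfies $A=H$. A fuzzy subset of $H$ is a map $f:H\to[0,1]$ (real interval). It is a fuzzy left ideal if for all $x,y\in H$ and all $u\in x\circ y$, $f(u)\ge f(y)$; a fuzzy right ideal if for all $x,y\in H$ and all $u\in x\circ y$, $f(u)\ge f(x)$; a fuzzy ideal if it is both a fuzzy left ideal and a fuzzy right ideal. $H$ is fuzzy simple if every fuzzy ideal $f$ of $H$ is a constant function, i.e. $f(a)=f(b)$ for all $a,b\in H$. *)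

(* Defs.v *)
From mathcomp Require Import all_boot all_order all_algebra.
From mathcomp Require Import boolp classical_sets reals interval_inference.
Set Implicit Arguments.
Unset Strict Implicit.
Unset Printing Implicit Defensive.

Local Open Scope classical_set_scope.
Local Open Scope ring_scope.

Record hypergroupoid := Hypergroupoid {
  carrier :> Type;
  carrier_nonempty : [set: carrier] !=set0;
  hop : carrier -> carrier -> set carrier;
  hop_nonempty : forall x y : carrier, hop x y !=set0
}.

Definition hmul (H : hypergroupoid) (A B : set H) : set H :=
  \bigcup_(p in A `*` B) hop p.1 p.2.

Definition ideal (H : hypergroupoid) (A : set H) : Prop :=
  [/\ A !=set0, hmul setT A `<=` A & hmul A setT `<=` A].

Definition simple (H : hypergroupoid) : Prop :=
  forall A : set H, ideal A -> A = setT.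

(* {i01 R} is the subtype of R of the elements of the closed interval [0, 1],
   with the order inherited from R. *)
Definition fuzzy_subset (R : realType) (H : hypergroupoid) := H -> {i01 R}.

Definition fuzzy_left_ideal (R : realType) (H : hypergroupoid)
    (f : fuzzy_subset R H) : Prop :=
  forall x y u : H, hop x y u -> (f u >= f y)%O.

Definition fuzzy_right_ideal (R : realType) (H : hypergroupoid)
    (f : fuzzy_subset R H) : Prop :=
  forall x y u : H, hop x y u -> (f u >= f x)%O.

Definition fuzzy_ideal (R : realType) (H : hypergroupoid)
    (f : fuzzy_subset R H) : Prop :=
  fuzzy_left_ideal f /\ fuzzy_right_ideal f.

Definition fuzzy_simple (R : realType) (H : hypergroupoid) : Prop :=
  forall f : fuzzy_subset R H, fuzzy_ideal f -> forall a b : H, f a = f b.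

(* Main.v *)
Require Import Defs.
From mathcomp Require Import all_boot all_order all_algebra.
From mathcomp Require Import boolp classical_sets reals interval_inference.

(** Ideals and fuzzy ideals determine each other through level sets and
    characteristic functions.

    If [f] is a fuzzy ideal, the values of [f] can only grow under [hop], so
    every upper level set [[set u | f a <= f u]] is an ideal, nonempty because
    it contains [a] ([level_set_ideal]).  When [H] is simple all these level
    sets are the whole of [H], which gives [f a <= f b] for all [a] and [b],
    and [f] is constant by antisymmetry.

    Conversely, the characteristic function of an ideal [A] is a fuzzy ideal
    ([char_fuzzy_ideal]).  When [H] is fuzzy simple it is constant, and it takes
    the value 1 somewhere since [A] is nonempty; as 0 and 1 differ, [A] is all
    of [H]. *)

Import Order.TTheory GRing.Theory Num.Theory.

Local Open Scope classical_set_scope.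
Local Open Scope ring_scope.

Lemma level_set_ideal (R : realType) (H : hypergroupoid)
    (f : fuzzy_subset R H) (a : H) :
  fuzzy_ideal f -> ideal [set u | (f a <= f u)%O].
Proof.
move=> [fl fr]; split; first by exists a => /=.
- by move=> u [[x y] [_ /= ay] /fl]; apply: le_trans.
- by move=> u [[x y] [/= ax _] /fr]; apply: le_trans.
Qed.

Definition char_fun (R : realType) (H : hypergroupoid) (A : set H) :
    fuzzy_subset R H :=
  fun x => if `[< A x >] then 1%:i01 else 0%:i01.

Lemma char_fun_le (R : realType) (H : hypergroupoid) (A : set H) (x u : H) :
  (A x -> A u) -> (char_fun R H A x <= char_fun R H A u)%O.
Proof.
move=> Axu; rewrite /char_fun; case: asboolP => [/Axu Au|_].
  by rewrite asboolT.
by case: asboolP => // _; rewrite -num_le /= ler01.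
Qed.

Lemma char_fuzzy_ideal (R : realType) (H : hypergroupoid) (A : set H) :
  ideal A -> fuzzy_ideal (char_fun R H A).
Proof.
move=> [_ Al Ar]; split=> x y u xyu; apply: char_fun_le => ?.
- by apply: Al; exists (x, y).
- by apply: Ar; exists (x, y).
Qed.

Theorem theorem2p23 (R : realType) (H : hypergroupoid) :
  simple H <-> fuzzy_simple R H.
Proof.
split=> [sH f fI a b | fsH A AI].
- have f_le c d : (f c <= f d)%O.
    have: [set u | (f c <= f u)%O] d by rewrite (sH _ (level_set_ideal _ _ _ c fI)).
    by [].
  by apply/le_anti; rewrite !f_le.
- have [[a Aa] _ _] := AI.
  rewrite -subTset => b _; apply: contrapT => nAb.
  have := fsH _ (char_fuzzy_ideal R H A AI) a b.
  rewrite /char_fun asboolT // asboolF // => /(congr1 (fun t => t%:num)) /=.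
  by move/eqP; rewrite oner_eq0.
Qed.
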